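(* Let $\approx$ be the congruence on the set $\mathcal{T}$ of types generated by a family of recursive equations $X_i \approx F_i$ ($i\in I$), where $F_i \in \mathcal{T}$, and assume that $\approx$ is good. Then every $\lambda\mu$-term that is typable in the simply typed $\lambda\mu$-calculus modulo $\approx$ is strongly normalizing: if $\Gamma \vdash M : T$ for some context $\Gamma$ and some type $T$, then there is no infinite $\rhd$-reduction sequence starting from $M$.
   Context: Terms. Let $\mathcal{V}$ ($\lambda$-variables $x,y,\dots$) and $\mathcal{W}$ ($\mu$-variables $\alpha,\beta,\dots$) be disjoint infinite sets. $\lambda\mu$-terms are given by $\mathcal{M} ::= \mathcal{V} \mid \lambda \mathcal{V}\,\mathcal{M} \mid (\mathcal{M}\;\mathcal{M}) \mid \mu\mathcal{W}\,\mathcal{M} \mid (\mathcal{W}\;\mathcal{M})$, up to renaming of bound variables. The relation $\rhd$ is the least relation compatible with contexts containing $(\lambda x\, M\; N) \rhd M[x:=N]$ and $(\mu\alpha\,M\;N)\rhd\mu\alpha\,M[\alpha=N]$, where $M[\alpha=N]$ is obtained from $M$ by (recursively) replacing each subterm of the form $(\alpha\;P)$ by $(\alpha\;(P\;N))$. Types. Let $\mathcal{A}$ be a set of atomic constants containing the symbol $\bot$ and $\mathcal{X}=\{X_i : i\in I\}$ a set of type variables. Types are given by $\mathcal{T} ::= \mathcal{A} \mid \mathcal{X} \mid \mathcal{T}\to\mathcal{T}$; $\neg U$ denotes $U\to\bot$. Given types $F_i$ ($i\in I$), the congruence $\approx$ generated by $E=\{F_i : i\in I\}$ is the least congruence on $\mathcal{T}$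 (equivalence relation compatible with $\to$) such that $X_i\approx F_i$ for each $i\in I$. Polarity. For $X\in\mathcal{X}$, the sets $\mathcal{T}^+(X),\mathcal{T}^-(X)\subseteq\mathcal{T}$ are defined inductively by: $X\in\mathcal{T}^+(X)$; if $U\in(\mathcal{X}\setminus\{X\})\cup\mathcal{A}$ then $U\in\mathcal{T}^+(X)\cap\mathcal{T}^-(X)$; if $U\in\mathcal{T}^-(X)$ and $V\in\mathcal{T}^+(X)$, then $U\to V\in\mathcal{T}^+(X)$ and $V\to U\in\mathcal{T}^-(X)$. The congruence $\approx$ is good if, for each $X\in\mathcal{X}$ and each type $T$, $X\approx T$ implies $T\in\mathcal{T}^+(X)$. Typing rules ($\Gamma$ is a set of declarations $x:U$ and $\alpha:\neg U$): (ax) $\Gamma,x:U\vdash x:U$; ($\approx$) from $\Gamma\vdash M:U$ and $U\approx V$ infer $\Gamma\vdash M:V$; ($\to_i$) from $\Gamma,x:U\vdash M:V$ infer $\Gamma\vdash\lambda x\,M:U\to V$; ($\to_e$) from $\Gamma\vdash M_1:U\to V$ and $\Gamma\vdash M_2:U$ infer $\Gamma\vdash(M_1\;M_2):V$; ($\bot_e$) from $\Gamma,\alpha:\neg U\vdash M:\bot$ infer $\Gamma\vdash\mu\alpha\,M:U$; ($\bot_i$) from $\Gamma,\alpha:\neg U\vdash M:U$ infer $\Gamma,\alpha:\neg U\vdash(\alpha\;M):\bot$. *)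

(* Defs.v *)
From Stdlib Require Import Arith.

Set Implicit Arguments.
Unset Strict Implicit.

(** * Terms

    Terms up to renaming of bound variables are de Bruijn terms, with two
    independent families of indices: [Lam] binds index 0 of the
    lambda-variables, [Mu] binds index 0 of the mu-variables. *)

Inductive term : Type :=
| Var (x : nat)
| Lam (M : term)
| App (M N : term)
| Mu (M : term)
| Name (a : nat) (M : term).

Definition up_ren (r : nat -> nat) (n : nat) : nat :=
  match n with
  | 0 => 0
  | S k => S (r k)
  end.

(** [rename r s M] renames the lambda-variables by [r] and the mu-variables
    by [s]. *)
Fixpoint rename (r s : nat -> nat) (M : term) : term :=
  match M with
  | Var x => Var (r x)
  | Lam M => Lam (rename (up_ren r) s M)
  | App M N => App (rename r s M) (rename r s N)
  | Mu M => Mu (rename r (up_ren s) M)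
  | Name a M => Name (s a) (rename r s M)
  end.

Definition lshift : term -> term := rename S (fun a => a).
Definition mshift : term -> term := rename (fun x => x) S.

Definition up_subst (s : nat -> term) (n : nat) : term :=
  match n with
  | 0 => Var 0
  | S k => lshift (s k)
  end.

Fixpoint subst (s : nat -> term) (M : term) : term :=
  match M with
  | Var x => s x
  | Lam M => Lam (subst (up_subst s) M)
  | App M N => App (subst s M) (subst s N)
  | Mu M => Mu (subst (fun x => mshift (s x)) M)
  | Name a M => Name a (subst s M)
  end.

(** [M[x:=N]] for [x] the lambda-variable 0, which is removed. *)
Definition subst0 (M N : term) : term :=
  subst (fun n => match n with 0 => N | S k => Var k end) M.

(** [M[a=N]]: every subterm [(a P)] becomes [(a (P N))], recursively. The
    mu-variable [a] is not removed. *)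
Fixpoint msubst (a : nat) (N M : term) : term :=
  match M with
  | Var x => Var x
  | Lam M => Lam (msubst a (lshift N) M)
  | App M1 M2 => App (msubst a N M1) (msubst a N M2)
  | Mu M => Mu (msubst (S a) (mshift N) M)
  | Name b P =>
      if Nat.eqb b a then Name b (App (msubst a N P) N)
      else Name b (msubst a N P)
  end.

Inductive red : term -> term -> Prop :=
| red_beta M N : red (App (Lam M) N) (subst0 M N)
| red_mu M N : red (App (Mu M) N) (Mu (msubst 0 (mshift N) M))
| red_Lam M M' : red M M' -> red (Lam M) (Lam M')
| red_App_l M M' N : red M M' -> red (App M N) (App M' N)
| red_App_r M N N' : red N N' -> red (App M N) (App M N')
| red_Mu M M' : red M M' -> red (Mu M) (Mu M')
| red_Name a M M' : red M M' -> red (Name a M) (Name a M').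

Definition strongly_normalizing (M : term) : Prop :=
  ~ exists f : nat -> term, f 0 = M /\ forall n, red (f n) (f (S n)).

(** * Types over the atomic constants [A] and the type variables [X_i], [i : I] *)

Inductive ty (A I : Type) : Type :=
| Atom (c : A)
| TVar (i : I)
| Arr (U V : ty A I).

Arguments Atom {A I} c.
Arguments TVar {A I} i.

(** The least congruence such that [X_i] is equivalent to [F i] for all [i]. *)
Inductive tequiv (A I : Type) (F : I -> ty A I) : ty A I -> ty A I -> Prop :=
| tequiv_eqn i : tequiv F (TVar i) (F i)
| tequiv_refl U : tequiv F U U
| tequiv_sym U V : tequiv F U V -> tequiv F V U
| tequiv_trans U V W : tequiv F U V -> tequiv F V W -> tequiv F U W
| tequiv_Arr U U' V V' :
    tequiv F U U' -> tequiv F V V' -> tequiv F (Arr U V) (Arr U' V').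

Inductive pos (A I : Type) (X : I) : ty A I -> Prop :=
| pos_self : pos X (TVar X)
| pos_TVar Y : Y <> X -> pos X (TVar Y)
| pos_Atom c : pos X (Atom c)
| pos_Arr U V : neg X U -> pos X V -> pos X (Arr U V)
with neg (A I : Type) (X : I) : ty A I -> Prop :=
| neg_TVar Y : Y <> X -> neg X (TVar Y)
| neg_Atom c : neg X (Atom c)
| neg_Arr U V : neg X U -> pos X V -> neg X (Arr V U).

Definition good (A I : Type) (F : I -> ty A I) : Prop :=
  forall (X : I) (T : ty A I), tequiv F (TVar X) T -> pos X T.

(** * Typing

    A context [Gamma] is split into its declarations [x : U] and its
    declarations [alpha : U -> bot], both as partial functions on indices. As
    the types declared for mu-variables are always negations, only [U] is
    recorded: [D a = Some U] stands for the declaration [a : U -> bot]. *)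

Definition ctx (A I : Type) : Type := nat -> option (ty A I).

Definition extend (A I : Type) (U : ty A I) (G : ctx A I) : ctx A I :=
  fun n => match n with
           | 0 => Some U
           | S k => G k
           end.

Inductive typing (A I : Type) (bot : A) (F : I -> ty A I) :
    ctx A I -> ctx A I -> term -> ty A I -> Prop :=
| ty_ax G D x U : G x = Some U -> typing bot F G D (Var x) U
| ty_equiv G D M U V :
    typing bot F G D M U -> tequiv F U V -> typing bot F G D M V
| ty_arr_i G D M U V :
    typing bot F (extend U G) D M V -> typing bot F G D (Lam M) (Arr U V)
| ty_arr_e G D M1 M2 U V :
    typing bot F G D M1 (Arr U V) -> typing bot F G D M2 U ->
    typing bot F G D (App M1 M2) V
| ty_bot_e G D M U :
    typing bot F G (extend U D) M (Atom bot) -> typing bot F G D (Mu M) U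
| ty_bot_i G D a M U :
    D a = Some U -> typing bot F G D M U ->
    typing bot F G D (Name a M) (Atom bot).

(* Main.v *)
(** A type is interpreted by a set of stacks (finite sequences of arguments), and a term belongs
    to it when its application to each of these stacks is strongly normalizing. Since sets of
    stacks form a complete lattice on which [->] is antitone on the left and monotone on the
    right, equations [X_i = F_i] can be solved by least fixed points. A derivation uses only
    finitely many equations; they are solved one variable at a time, a variable [X] being solved
    by the least fixed point of [F X] in which the variables already treated are replaced by
    their solutions as functions of [X]. The invariant is that if [Y] occurs only positively
    (negatively) in all the types equivalent to [T], then the interpretation of [T] is monotone
    (antitone) in the value of [Y]; goodness thus makes each of the operators monotone. *)

From Stdlib Require Import List Bool Relations.
From Stdlib Require Import Classical ClassicalEpsilon FunctionalExtensionality PropExtensionality.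
Require Import Defs.
Import ListNotations.

(** * Simultaneous substitution of terms and stacks *)

Lemma map_fixed {T : Type} (f : T -> T) l : (forall t, f t = t) -> map f l = l.
Proof. intro H; rewrite (map_ext _ (fun t => t) H); apply map_id. Qed.

Definition apps (M : term) (l : list term) : term := fold_left App l M.

Lemma apps_app M l l' : apps M (l ++ l') = apps (apps M l) l'.
Proof. apply fold_left_app. Qed.

Definition up_stack (p : nat -> list term) (a : nat) : list term :=
  match a with
  | 0 => []
  | S k => map mshift (p k)
  end.

(** A single traversal combines substitution of terms, renaming of mu-variables and structural
    substitution, which hands a whole stack to each named subterm. [rename], [subst] and [msubst]
    are instances, so one composition law serves them all. *)
Fixpoint sub (s : nat -> term) (r : nat -> nat) (p : nat -> list term) (M : term) : term :=
  match M with
  | Var x => s x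
  | Lam M => Lam (sub (up_subst s) r (fun a => map lshift (p a)) M)
  | App M N => App (sub s r p M) (sub s r p N)
  | Mu M => Mu (sub (fun x => mshift (s x)) (up_ren r) (up_stack p) M)
  | Name a M => Name (r a) (apps (sub s r p M) (p a))
  end.

Lemma sub_ext s s' r r' p p' M :
  (forall x, s x = s' x) -> (forall a, r a = r' a) -> (forall a, p a = p' a) ->
  sub s r p M = sub s' r' p' M.
Proof.
  intros Hs Hr Hp.
  rewrite (functional_extensionality _ _ Hs), (functional_extensionality _ _ Hr),
    (functional_extensionality _ _ Hp).
  reflexivity.
Qed.

Lemma rename_ext f f' g g' M :
  (forall x, f x = f' x) -> (forall a, g a = g' a) -> rename f g M = rename f' g' M.
Proof.
  intros Hf Hg.
  rewrite (functional_extensionality _ _ Hf), (functional_extensionality _ _ Hg).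
  reflexivity.
Qed.

Lemma rename_apps f g l : forall M, rename f g (apps M l) = apps (rename f g M) (map (rename f g) l).
Proof. induction l as [|N l IH]; intro M; simpl; [reflexivity|apply IH]. Qed.

Lemma sub_apps s r p l : forall M, sub s r p (apps M l) = apps (sub s r p M) (map (sub s r p) l).
Proof. induction l as [|N l IH]; intro M; simpl; [reflexivity|apply IH]. Qed.

Lemma rename_rename M : forall f g f' g',
  rename f g (rename f' g' M) = rename (fun x => f (f' x)) (fun a => g (g' a)) M.
Proof.
  induction M as [x|M IH|M IHM N IHN|M IH|a M IH]; intros; simpl; f_equal; auto;
    rewrite IH; apply rename_ext; intros [|k]; reflexivity.
Qed.

Lemma rename_lshift f g M : rename (up_ren f) g (lshift M) = lshift (rename f g M).
Proof. unfold lshift; rewrite !rename_rename; reflexivity. Qed.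

Lemma rename_mshift f g M : rename f (up_ren g) (mshift M) = mshift (rename f g M).
Proof. unfold mshift; rewrite !rename_rename; reflexivity. Qed.

Lemma sub_rename M : forall s r p f g,
  sub s r p (rename f g M) = sub (fun x => s (f x)) (fun a => r (g a)) (fun a => p (g a)) M.
Proof.
  induction M as [x|M IH|M IHM N IHN|M IH|a M IH]; intros; simpl; f_equal; auto.
  - rewrite IH; apply sub_ext; try reflexivity; intros [|k]; reflexivity.
  - rewrite IH; apply sub_ext; try reflexivity; intros [|k]; reflexivity.
  - rewrite IH; reflexivity.
Qed.

Lemma rename_sub M : forall f g s r p,
  rename f g (sub s r p M) =
  sub (fun x => rename f g (s x)) (fun a => g (r a)) (fun a => map (rename f g) (p a)) M.
Proof.
  induction M as [x|M IH|M IHM N IHN|M IH|a M IH]; intros; simpl; f_equal; auto.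
  - rewrite IH; apply sub_ext; try reflexivity.
    + intros [|k]; simpl; [reflexivity|apply rename_lshift].
    + intro a; rewrite !map_map; apply map_ext; intro; apply rename_lshift.
  - rewrite IH; apply sub_ext.
    + intro x; apply rename_mshift.
    + intros [|k]; reflexivity.
    + intros [|k]; simpl; [reflexivity|].
      rewrite !map_map; apply map_ext; intro; apply rename_mshift.
  - rewrite rename_apps, IH; reflexivity.
Qed.

Lemma sub_lshift s r p M :
  sub (up_subst s) r (fun a => map lshift (p a)) (lshift M) = lshift (sub s r p M).
Proof. unfold lshift at 2 3; rewrite sub_rename, rename_sub; reflexivity. Qed.

Lemma sub_mshift s r p M :
  sub (fun x => mshift (s x)) (up_ren r) (up_stack p) (mshift M) = mshift (sub s r p M).
Proof. unfold mshift at 2 3; rewrite sub_rename, rename_sub; reflexivity. Qed.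

(** The inner substitution leaves the name [r a] with the arguments [p a], and the outer one appends
    [p' (r a)] after them: stacks compose by concatenation. *)
Lemma sub_sub M : forall s r p s' r' p',
  sub s' r' p' (sub s r p M) =
  sub (fun x => sub s' r' p' (s x)) (fun a => r' (r a))
    (fun a => map (sub s' r' p') (p a) ++ p' (r a)) M.
Proof.
  induction M as [x|M IH|M IHM N IHN|M IH|a M IH]; intros; simpl; f_equal; auto.
  - rewrite IH; apply sub_ext; try reflexivity.
    + intros [|k]; simpl; [reflexivity|apply sub_lshift].
    + intro a; rewrite map_app, !map_map; f_equal; apply map_ext; intro; apply sub_lshift.
  - rewrite IH; apply sub_ext.
    + intro x; apply sub_mshift.
    + intros [|k]; reflexivity.
    + intros [|k]; simpl; [reflexivity|].
      rewrite map_app, !map_map; f_equal; apply map_ext; intro; apply sub_mshift.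
  - rewrite sub_apps, IH, apps_app; reflexivity.
Qed.

Lemma rename_as_sub M : forall f g,
  rename f g M = sub (fun x => Var (f x)) g (fun _ => []) M.
Proof.
  induction M as [x|M IH|M IHM N IHN|M IH|a M IH]; intros; simpl; f_equal; auto;
    rewrite IH; apply sub_ext; try reflexivity; intros [|k]; reflexivity.
Qed.

Lemma subst_as_sub M : forall s, subst s M = sub s (fun a => a) (fun _ => []) M.
Proof.
  induction M as [x|M IH|M IHM N IHN|M IH|a M IH]; intros; simpl; f_equal; auto;
    rewrite IH; apply sub_ext; try reflexivity; intros [|k]; reflexivity.
Qed.

Lemma sub_id M : sub Var (fun a => a) (fun _ => []) M = M.
Proof.
  induction M as [x|M IH|M IHM N IHN|M IH|a M IH]; simpl; f_equal; auto;
    rewrite <- IH at 2; apply sub_ext; try reflexivity; intros [|k]; reflexivity.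
Qed.

Lemma msubst_as_sub M : forall a N,
  msubst a N M = sub Var (fun b => b) (fun b => if Nat.eqb b a then [N] else []) M.
Proof.
  induction M as [x|M IH|M IHM P IHP|M IH|b M IH]; intros; simpl.
  - reflexivity.
  - f_equal; rewrite IH; apply sub_ext; try reflexivity.
    + intros [|k]; reflexivity.
    + intro b; destruct (Nat.eqb b a); reflexivity.
  - f_equal; auto.
  - f_equal; rewrite IH; apply sub_ext; try reflexivity.
    + intros [|k]; reflexivity.
    + intros [|k]; simpl; [reflexivity|]; destruct (Nat.eqb k a); reflexivity.
  - rewrite IH; destruct (Nat.eqb b a); reflexivity.
Qed.

Definition scons {T : Type} (t : T) (f : nat -> T) (n : nat) : T :=
  match n with 0 => t | S k => f k end.

Lemma msubst0_as_sub N M :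
  msubst 0 N M = sub Var (fun b => b) (scons [N] (fun _ => [])) M.
Proof. rewrite msubst_as_sub; apply sub_ext; try reflexivity; intros [|k]; reflexivity. Qed.

Lemma subst0_as_sub M N : subst0 M N = sub (scons N Var) (fun a => a) (fun _ => []) M.
Proof. unfold subst0; rewrite subst_as_sub; reflexivity. Qed.

Lemma subst0_sub s r p M N :
  subst0 (sub (up_subst s) r (fun a => map lshift (p a)) M) N = sub (scons N s) r p M.
Proof.
  rewrite subst0_as_sub, sub_sub; apply sub_ext; try reflexivity.
  - intros [|k]; simpl; [reflexivity|].
    unfold lshift; rewrite sub_rename; apply sub_id.
  - intro a; rewrite app_nil_r, map_map; apply map_fixed.
    intro P; unfold lshift; rewrite sub_rename; apply sub_id.
Qed.

Lemma sub_subst0 s r p M N :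
  sub s r p (subst0 M N) =
  subst0 (sub (up_subst s) r (fun a => map lshift (p a)) M) (sub s r p N).
Proof.
  rewrite subst0_sub, subst0_as_sub, sub_sub; apply sub_ext; try reflexivity.
  intros [|k]; reflexivity.
Qed.

Lemma sub_scons_mshift l r M :
  sub Var r (scons l (fun _ => [])) (mshift M) = rename (fun x => x) (fun a => r (S a)) M.
Proof. unfold mshift; rewrite sub_rename, rename_as_sub; reflexivity. Qed.

Lemma sub_msubst0 s r p M N :
  sub (fun x => mshift (s x)) (up_ren r) (up_stack p) (msubst 0 (mshift N) M) =
  msubst 0 (mshift (sub s r p N)) (sub (fun x => mshift (s x)) (up_ren r) (up_stack p) M).
Proof.
  rewrite !msubst0_as_sub, !sub_sub; apply sub_ext.
  - intro x; simpl; rewrite sub_scons_mshift; reflexivity.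
  - reflexivity.
  - intros [|k]; simpl.
    + rewrite sub_mshift; reflexivity.
    + rewrite app_nil_r, map_map; apply map_ext; intro; rewrite sub_scons_mshift; reflexivity.
Qed.

(** * Reduction under substitution *)

Lemma red_apps l : forall M M', red M M' -> red (apps M l) (apps M' l).
Proof. induction l as [|N l IH]; intros M M' H; simpl; auto using red_App_l. Qed.

Lemma red_sub M M' : red M M' -> forall s r p, red (sub s r p M) (sub s r p M').
Proof.
  induction 1; intros; simpl; auto using red_Lam, red_App_l, red_App_r, red_Mu, red_Name, red_apps.
  - rewrite sub_subst0; apply red_beta.
  - rewrite sub_msubst0; apply red_mu.
Qed.

Definition reds : term -> term -> Prop := clos_refl_trans term red.

Lemma reds_map (f : term -> term) :
  (forall M M', red M M' -> red (f M) (f M')) -> forall M M', reds M M' -> reds (f M) (f M').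
Proof.
  intros Hf M M'; induction 1; [apply rt_step; auto|apply rt_refl|eapply rt_trans; eassumption].
Qed.

Lemma reds_App M M' N N' : reds M M' -> reds N N' -> reds (App M N) (App M' N').
Proof.
  intros HM HN; apply rt_trans with (App M' N).
  - apply (reds_map (fun M => App M N)); auto using red_App_l.
  - apply (reds_map (App M')); auto using red_App_r.
Qed.

Lemma reds_apps l l' : Forall2 reds l l' ->
  forall M M', reds M M' -> reds (apps M l) (apps M' l').
Proof. induction 1; intros; simpl; auto using reds_App. Qed.

Lemma reds_rename f g M M' : reds M M' -> reds (rename f g M) (rename f g M').
Proof. apply reds_map; intros; rewrite !rename_as_sub; apply red_sub; assumption. Qed.

Lemma Forall2_reds_rename f g l l' :
  Forall2 reds l l' -> Forall2 reds (map (rename f g) l) (map (rename f g) l').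
Proof. induction 1; simpl; auto using reds_rename. Qed.

(** Many-step reduction is the right notion here because the substituted terms may be duplicated or
    erased. *)
Lemma reds_sub M : forall s s' r p p',
  (forall x, reds (s x) (s' x)) -> (forall a, Forall2 reds (p a) (p' a)) ->
  reds (sub s r p M) (sub s' r p' M).
Proof.
  induction M as [x|M IH|M IHM N IHN|M IH|a M IH]; intros s s' r p p' Hs Hp; simpl.
  - apply Hs.
  - apply (reds_map Lam); [auto using red_Lam|]; apply IH.
    + intros [|k]; [apply rt_refl|apply reds_rename, Hs].
    + intro a; apply Forall2_reds_rename, Hp.
  - apply reds_App; auto.
  - apply (reds_map Mu); [auto using red_Mu|]; apply IH.
    + intro x; apply reds_rename, Hs.
    + intros [|k]; [constructor|apply Forall2_reds_rename, Hp].
  - apply (reds_map (Name (r a))); [auto using red_Name|]; apply reds_apps; auto.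
Qed.

(** * Strong normalization and head expansion *)

Definition SN : term -> Prop := Acc (fun N M => red M N).

Lemma SN_red M N : SN M -> red M N -> SN N.
Proof. intros H; apply (Acc_inv H). Qed.

Lemma SN_reds M N : SN M -> reds M N -> SN N.
Proof. intros H HR; revert H; induction HR; eauto using SN_red. Qed.

Lemma SN_preimage (f : term -> term) :
  (forall M M', red M M' -> red (f M) (f M')) -> forall M, SN (f M) -> SN M.
Proof.
  intros Hf M H; remember (f M) as N eqn:E; revert M E.
  induction H as [N _ IH]; intros M ->; constructor; intros M' HM.
  apply (IH (f M')); auto.
Qed.

Lemma SN_sub s r p M : SN (sub s r p M) -> SN M.
Proof. apply SN_preimage; auto using red_sub. Qed.

Lemma SN_Lam M : SN M -> SN (Lam M).
Proof.
  induction 1 as [M _ IH]; constructor; intros N H; inversion H; subst; apply IH; assumption.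
Qed.

Lemma SN_Mu M : SN M -> SN (Mu M).
Proof.
  induction 1 as [M _ IH]; constructor; intros N H; inversion H; subst; apply IH; assumption.
Qed.

Lemma SN_Name a M : SN M -> SN (Name a M).
Proof.
  induction 1 as [M _ IH]; constructor; intros N H; inversion H; subst; apply IH; assumption.
Qed.

Definition is_abs (M : term) : Prop :=
  match M with Lam _ | Mu _ => True | _ => False end.

Inductive red_list : list term -> list term -> Prop :=
| red_list_here N N' l : red N N' -> red_list (N :: l) (N' :: l)
| red_list_there N l l' : red_list l l' -> red_list (N :: l) (N :: l').

(** No redex arises at the junction of [M] with its first argument. The condition passes to
    [App M N], which is not an abstraction either. *)
Lemma red_apps_inv l : forall M Z, ~ is_abs M -> red (apps M l) Z ->
  (exists M', red M M' /\ Z = apps M' l) \/ (exists l', red_list l l' /\ Z = apps M l').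
Proof.
  induction l as [|N l IH]; intros M Z HM H; simpl in H; [eauto|].
  apply IH in H; [|auto].
  destruct H as [(M' & H & ->)|(l' & H & ->)].
  - inversion H; subst; simpl in HM; try tauto.
    + left; eexists; split; [eassumption|reflexivity].
    + right; exists (N' :: l); auto using red_list.
  - right; exists (N :: l'); auto using red_list.
Qed.

Lemma red_apps_list l l' : red_list l l' -> forall M, red (apps M l) (apps M l').
Proof. induction 1; intro M; simpl; auto using red_apps, red_App_r. Qed.

Definition fire (H P : term) : term :=
  match H with
  | Lam M => subst0 M P
  | Mu M => Mu (msubst 0 (mshift P) M)
  | _ => H
  end.

Lemma red_fire_l H H' P : is_abs H -> red H H' -> is_abs H' /\ red (fire H P) (fire H' P).
Proof.
  intros HH HR; destruct HR; simpl in HH; try tauto; split; simpl; auto.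
  - rewrite !subst0_as_sub; apply red_sub; assumption.
  - rewrite !msubst0_as_sub; apply red_Mu, red_sub; assumption.
Qed.

Lemma reds_fire_r H P P' : red P P' -> reds (fire H P) (fire H P').
Proof.
  intro HR; destruct H as [x|M|M N|M|a M]; simpl; try apply rt_refl.
  - rewrite !subst0_as_sub; apply reds_sub; [|auto].
    intros [|k]; [apply rt_step, HR|apply rt_refl].
  - apply (reds_map Mu); [auto using red_Mu|].
    rewrite !msubst0_as_sub; apply reds_sub; [intro; apply rt_refl|].
    intros [|k]; [|constructor].
    constructor; [apply reds_rename, rt_step, HR|constructor].
Qed.

(** The outer induction is on [P], the inner one on the contractum. A step in [H] or [l] induces a
    step of the contractum, whereas a step in [P] may leave the contractum unchanged and is paid for
    by [P] itself. *)
Lemma SN_fire P : SN P -> forall H l, is_abs H -> SN (apps (fire H P) l) -> SN (apps (App H P) l).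
Proof.
  induction 1 as [P HP IHP]; intros H l HH HS.
  remember (apps (fire H P) l) as C eqn:E; revert H l HH E.
  induction HS as [C HC IHC]; intros H l HH ->; constructor; intros Z HZ.
  apply red_apps_inv in HZ; [|auto].
  destruct HZ as [(Q & HQ & ->)|(l' & Hl & ->)].
  (* Contracting the head redex gives the contractum itself; a step in [H] and a step in [P]
     remain. *)
  - inversion HQ; subst; try (constructor; exact HC).
    + match goal with HR : red H _ |- _ => destruct (red_fire_l H _ P HH HR) as [HH' HF] end.
      eapply IHC; [|exact HH'|reflexivity]; apply red_apps, HF.
    + apply IHP; [assumption|assumption|].
      apply SN_reds with (apps (fire H P) l); [constructor; exact HC|].
      apply (reds_map (fun M => apps M l)); [intros; apply red_apps; assumption|].
      apply reds_fire_r; assumption.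
  - eapply IHC; [|exact HH|reflexivity]; apply red_apps_list, Hl.
Qed.

(** The binder absorbs the arguments one after another, each by a head expansion; the successive
    structural substitutions compose into one that gives the bound variable the whole stack [l]. *)
Lemma SN_apps_Mu l : forall M, Forall SN l ->
  SN (sub Var (fun a => a) (scons (map mshift l) (fun _ => [])) M) -> SN (apps (Mu M) l).
Proof.
  induction l as [|P l IH]; intros M Hl HM.
  - apply SN_Mu; eapply SN_sub; eassumption.
  - inversion Hl; subst; simpl.
    apply SN_fire; [assumption|exact I|]; simpl.
    apply IH; [assumption|].
    rewrite msubst0_as_sub, sub_sub.
    erewrite sub_ext; [exact HM|reflexivity|reflexivity|].
    intros [|k]; simpl; [|reflexivity].
    rewrite sub_scons_mshift; reflexivity.
Qed.

Lemma SN_list l : Forall SN l -> Acc (fun l' l => red_list l l') l.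
Proof.
  induction 1 as [|N l HN _ IHl].
  - constructor; intros l' H; inversion H.
  - revert l IHl; induction HN as [N _ IHN]; intros l Hl.
    induction Hl as [l Hl IHl]; constructor; intros l' H; inversion H; subst; auto.
    apply IHN; [assumption|constructor; assumption].
Qed.

Lemma SN_apps_Var x l : Forall SN l -> SN (apps (Var x) l).
Proof.
  intro H; apply SN_list in H; induction H as [l _ IH]; constructor; intros Z HZ.
  apply red_apps_inv in HZ; [|auto].
  destruct HZ as [(M' & H & _)|(l' & H & ->)]; [inversion H|apply IH, H].
Qed.

(** * Sets of stacks *)

Definition stacks : Type := list term -> Prop.

(** An arbitrary set of stacks [P] is read as the set of its strongly normalizing members
    together with the empty stack, so that the interpretations of the type variables range over
    the whole complete lattice [stacks]. *)
Definition stack_of (P : stacks) (l : list term) : Prop := l = [] \/ P l /\ Forall SN l.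

Definition orth (P : stacks) (M : term) : Prop := forall l, stack_of P l -> SN (apps M l).

(** The empty stack is left out since [stack_of] always restores it. *)
Definition arrow (P Q : stacks) : stacks := fun l =>
  match l with
  | [] => False
  | N :: l => orth P N /\ stack_of Q l
  end.

Lemma orth_SN P M : orth P M -> SN M.
Proof. intro H; apply (H []); left; reflexivity. Qed.

Lemma stack_of_SN P l : stack_of P l -> Forall SN l.
Proof. intros [->|[_ H]]; auto. Qed.

Lemma orth_Var P x : orth P (Var x).
Proof. intros l H; apply SN_apps_Var, (stack_of_SN _ _ H). Qed.

Lemma orth_App P Q M N : orth (arrow P Q) M -> orth P N -> orth Q (App M N).
Proof.
  intros HM HN l Hl; apply (HM (N :: l)); right; split; [split; assumption|].
  constructor; [eapply orth_SN; eassumption|eapply stack_of_SN; eassumption].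
Qed.

(** * Inclusion and least fixed points *)

Definition le (P Q : stacks) : Prop := forall l, P l -> Q l.

Lemma le_antisym P Q : le P Q -> le Q P -> P = Q.
Proof.
  intros H H'; apply functional_extensionality; intro l.
  apply propositional_extensionality; split; auto.
Qed.

Lemma stack_of_le P Q : le P Q -> le (stack_of P) (stack_of Q).
Proof. intros H l [->|[Hl HS]]; [left|right]; auto. Qed.

Lemma arrow_le P P' Q Q' : le P' P -> le Q Q' -> le (arrow P Q) (arrow P' Q').
Proof.
  intros HP HQ [|N l]; simpl; [auto|]; intros [HN Hl]; split.
  - intros l' Hl'; apply HN, (stack_of_le _ _ HP), Hl'.
  - apply (stack_of_le _ _ HQ), Hl.
Qed.

(** The Knaster-Tarski construction: the intersection of all pre-fixed points. *)
Definition lfp (f : stacks -> stacks) : stacks := fun l => forall R, le (f R) R -> R l.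

Lemma lfp_fix f : (forall R R', le R R' -> le (f R) (f R')) -> lfp f = f (lfp f).
Proof.
  intro Hf.
  assert (H : le (f (lfp f)) (lfp f)).
  { intros l Hl R HR; apply HR; revert l Hl; apply Hf; intros l Hl; apply Hl, HR. }
  apply le_antisym; [|exact H].
  intros l Hl; apply Hl, Hf, H.
Qed.

Lemma lfp_le f f' : (forall R, le (f R) (f' R)) -> le (lfp f) (lfp f').
Proof. intros H l Hl R HR; apply Hl; intros l' Hl'; apply HR, H, Hl'. Qed.

Definition le_dir (b : bool) (P Q : stacks) : Prop := if b then le P Q else le Q P.

(** * Interpretation of types *)

Section Types.

Variables (A I : Type) (bot : A) (F : I -> ty A I).

(** For an atom, [stack_of] leaves only the empty stack, so the terms of atomic type, [bot]
    included, are interpreted by strong normalization alone. *)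
Fixpoint interp (v : I -> stacks) (T : ty A I) : stacks :=
  match T with
  | Atom _ => fun _ => False
  | TVar i => v i
  | Arr U V => arrow (interp v U) (interp v V)
  end.

Definition update (v : I -> stacks) (X : I) (R : stacks) (i : I) : stacks :=
  if excluded_middle_informative (i = X) then R else v i.

Lemma update_eq v X R : update v X R X = R.
Proof. unfold update; destruct excluded_middle_informative; congruence. Qed.

Lemma update_neq v X R i : i <> X -> update v X R i = v i.
Proof. unfold update; destruct excluded_middle_informative; congruence. Qed.

Lemma update_comm v X Y R S : X <> Y ->
  update (update v X R) Y S = update (update v Y S) X R.
Proof.
  intro H; apply functional_extensionality; intro i; unfold update.
  destruct (excluded_middle_informative (i = Y)), (excluded_middle_informative (i = X));
    congruence.
Qed.

(** [polar true X T] is [pos X T] and [polar false X T] is [neg X T]. *)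
Fixpoint polar (b : bool) (X : I) (T : ty A I) : Prop :=
  match T with
  | Atom _ => True
  | TVar Y => b = true \/ Y <> X
  | Arr U V => polar (negb b) X U /\ polar b X V
  end.

Scheme pos_mut := Minimality for pos Sort Prop
  with neg_mut := Minimality for neg Sort Prop.

Lemma pos_polar (X : I) (T : ty A I) : pos X T -> polar true X T.
Proof. apply (pos_mut A I X (polar true X) (polar false X)); simpl; auto. Qed.

(** * Polarity modulo finitely many equations *)

Inductive equiv_in (J : list I) : ty A I -> ty A I -> Prop :=
| equiv_in_eqn i : In i J -> equiv_in J (TVar i) (F i)
| equiv_in_refl U : equiv_in J U U
| equiv_in_sym U V : equiv_in J U V -> equiv_in J V U
| equiv_in_trans U V W : equiv_in J U V -> equiv_in J V W -> equiv_in J U W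
| equiv_in_Arr U U' V V' :
    equiv_in J U U' -> equiv_in J V V' -> equiv_in J (Arr U V) (Arr U' V').

Lemma equiv_in_tequiv J U V : equiv_in J U V -> tequiv F U V.
Proof. induction 1; eauto using tequiv. Qed.

Lemma equiv_in_incl J J' U V : incl J J' -> equiv_in J U V -> equiv_in J' U V.
Proof. intro H; induction 1; eauto using equiv_in. Qed.

(** The whole class matters because a variable of [J] occurring in [T] is interpreted by its
    solution, which may depend on [X] through its equation. *)
Definition polar_class (J : list I) (b : bool) (X : I) (T : ty A I) : Prop :=
  forall T', equiv_in J T T' -> polar b X T'.

Lemma polar_class_equiv J b X T T' :
  equiv_in J T T' -> polar_class J b X T -> polar_class J b X T'.
Proof. intros H HT U HU; apply HT; eauto using equiv_in. Qed.

Lemma polar_class_incl J J' b X T :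
  incl J J' -> polar_class J' b X T -> polar_class J b X T.
Proof. intros H HT U HU; apply HT; eauto using equiv_in_incl. Qed.

Lemma polar_class_Arr J b X U V :
  polar_class J b X (Arr U V) -> polar_class J (negb b) X U /\ polar_class J b X V.
Proof.
  intro H; split; intros T HT.
  - apply (H (Arr T V)), equiv_in_Arr; [exact HT|apply equiv_in_refl].
  - apply (H (Arr U T)), equiv_in_Arr; [apply equiv_in_refl|exact HT].
Qed.

(** [~ polar c X T] yields an occurrence of [X] in [T], of the polarity opposite to [c], in
    which any type equivalent to [X] may be substituted. *)
Lemma polar_class_occurrence J c X Y T : forall b,
  ~ polar c X T -> polar_class J b Y T -> polar_class J (xorb b c) Y (TVar X).
Proof.
  revert c; induction T as [a|i|U IHU V IHV]; intros c b Hc HT; simpl in Hc.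
  - tauto.
  - destruct (classic (i = X)) as [->|]; [|tauto].
    destruct c; [tauto|]; rewrite xorb_false_r; exact HT.
  - apply polar_class_Arr in HT; destruct HT as [HU HV].
    apply not_and_or in Hc; destruct Hc as [Hc|Hc].
    + replace (xorb b c) with (xorb (negb b) (negb c)) by (destruct b, c; reflexivity).
      auto.
    + auto.
Qed.

(** Some member of the class of [T] has an occurrence of [X] of sign opposite to [c]. Replacing it
    by types equivalent to [X] stays in the class, which dictates the polarity of [Y] in those
    types. *)
Lemma polar_class_not J J' c b X Y T : incl J J' ->
  ~ polar_class J c X T -> polar_class J' b Y T -> polar_class J' (xorb b c) Y (TVar X).
Proof.
  intros HJ Hc HT; apply not_all_ex_not in Hc; destruct Hc as [T' Hc].
  apply imply_to_and in Hc; destruct Hc as [HE Hc].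
  apply (polar_class_occurrence J' c X Y T'); [exact Hc|].
  eapply polar_class_equiv; [|exact HT]; eauto using equiv_in_incl.
Qed.

(** * Solving the equations of a finite list *)

Fixpoint solve (J : list I) (v : I -> stacks) : I -> stacks :=
  match J with
  | [] => v
  | X :: J => solve J (update v X (lfp (fun R => interp (solve J (update v X R)) (F X))))
  end.

Definition solves (J : list I) (v : I -> stacks) : Prop :=
  forall i, In i J -> v i = interp v (F i).

(** [X] is a parameter outside the unknowns [J], and [v] is arbitrary, so that an induction on [J]
    can treat the head of the list as a further parameter. *)
Definition monotone_solution (J : list I) : Prop :=
  forall b X T v R R', ~ In X J -> polar_class J b X T -> le R R' ->
  le_dir b (interp (solve J (update v X R)) T) (interp (solve J (update v X R')) T).

Lemma interp_nil_le b X T v R R' : polar b X T -> le R R' ->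
  le_dir b (interp (update v X R) T) (interp (update v X R') T).
Proof.
  intros HT HR; revert b HT; induction T as [a|i|U IHU V IHV]; intros b HT; simpl in *.
  - destruct b; simpl; intros l [].
  - destruct (classic (i = X)) as [->|Hi].
    + rewrite !update_eq; destruct HT as [->|]; [exact HR|congruence].
    + rewrite !update_neq by assumption; destruct b; intros l Hl; exact Hl.
  - destruct HT as [HU HV]; specialize (IHU _ HU); specialize (IHV _ HV).
    destruct b; simpl in *; apply arrow_le; assumption.
Qed.

Hypothesis F_good : good F.

(** Goodness enters here: [F X] is equivalent to [X], so every type in its class is positive in
    [X]. *)
Lemma monotone_equation J X v R R' : ~ In X J -> monotone_solution J -> le R R' ->
  le (interp (solve J (update v X R)) (F X)) (interp (solve J (update v X R')) (F X)).
Proof.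
  intros HX HJ HR; apply (HJ true); [exact HX| |exact HR].
  intros T HT; apply pos_polar, F_good.
  eapply tequiv_trans; [apply tequiv_eqn|eapply equiv_in_tequiv, HT].
Qed.

(** A change of [Y] acts on [T] directly and through the value [L R] of [X]. The two effects are
    compared separately and composed: the direct one by induction, the other according to the
    polarity of [X] in the class of [T]. *)
Lemma solve_monotone J : NoDup J -> monotone_solution J.
Proof.
  induction 1 as [|X J HX _ IH]; intros b Y T v R R' HY HT HR; simpl.
  - apply interp_nil_le; [apply HT; constructor|exact HR].
  - apply not_in_cons in HY; destruct HY as [HYX HY].
    assert (HJ : incl J (X :: J)) by (intros i Hi; right; exact Hi).
    set (W R S T := interp (solve J (update (update v Y R) X S)) T).
    assert (WY : forall b S T, polar_class J b Y T -> le_dir b (W R S T) (W R' S T)).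
    { intros c S U HU; unfold W; rewrite !(update_comm v Y X) by assumption.
      apply IH; assumption. }
    assert (WX : forall b R S S' T, polar_class J b X T -> le S S' ->
                   le_dir b (W R S T) (W R S' T)).
    { intros c Q S S' U HU HS; apply IH; assumption. }
    set (L R := lfp (fun S => W R S (F X))).
    (* Since [X] and [F X] are equivalent modulo [X :: J], the polarity of [Y] in the class of [X]
       tells how the operator varies, and its least fixed point varies likewise. *)
    assert (HL : forall c, polar_class (X :: J) c Y (TVar X) -> le_dir c (L R) (L R')).
    { intros c Hc.
      assert (HF : forall S, le_dir c (W R S (F X)) (W R' S (F X))).
      { intro S; apply WY, (polar_class_incl J (X :: J)); [exact HJ|].
        eapply polar_class_equiv; [|exact Hc]; constructor; left; reflexivity. }
      destruct c; apply lfp_le; exact HF. }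
    change (le_dir b (W R (L R) T) (W R' (L R') T)).
    assert (HTJ : polar_class J b Y T) by (eapply polar_class_incl; eassumption).
    (* Each sign with which [X] occurs in the class of [T] yields one comparison of [L R] with
       [L R']. *)
    pose proof (fun c H => HL _ (polar_class_not J (X :: J) c b X Y T HJ H HT)) as HN.
    assert (HE : W R' (L R) T = W R' (L R') T \/ le_dir b (W R' (L R) T) (W R' (L R') T)).
    { destruct (classic (polar_class J true X T)) as [Hp|Hp],
        (classic (polar_class J false X T)) as [Hn|Hn].
      - (* [X] does not occur in the class of [T], and [L R], [L R'] need not be comparable. *)
        assert (H0 : forall S, W R' (fun _ => False) T = W R' S T).
        { intro S; apply le_antisym; [apply (WX true)|apply (WX false)]; try assumption;
            intros l []. }
        left; rewrite <- (H0 (L R)), <- (H0 (L R')); reflexivity.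
      - right; apply HN in Hn; rewrite xorb_false_r in Hn.
        destruct b; apply (WX true); assumption.
      - right; apply HN in Hp; destruct b; apply (WX false); assumption.
      (* Here [X] occurs with both signs, and the two comparisons force [L R = L R']. *)
      - left; f_equal; apply HN in Hp; apply HN in Hn.
        destruct b; apply le_antisym; assumption. }
    specialize (WY b (L R) T HTJ).
    destruct HE as [<-|HE]; [exact WY|].
    destruct b; intros l Hl; auto.
Qed.

Lemma solve_outside J : forall v i, ~ In i J -> solve J v i = v i.
Proof.
  induction J as [|X J IH]; intros v i Hi; simpl; [reflexivity|].
  apply not_in_cons in Hi; destruct Hi as [HiX Hi].
  rewrite IH by assumption; apply update_neq; assumption.
Qed.

(** Without repetitions, solving the tail leaves the value of [X] untouched, and its fixed point
    equation is the equation for [X]. *)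
Lemma solve_solves J : NoDup J -> forall v, solves J (solve J v).
Proof.
  induction 1 as [|X J HX HJ IH]; intros v i Hi; [destruct Hi|].
  destruct Hi as [<-|Hi]; [|apply IH, Hi].
  simpl; rewrite solve_outside, update_eq by assumption.
  apply (lfp_fix (fun R => interp (solve J (update v X R)) (F X))).
  intros R R' HR; apply monotone_equation; auto using solve_monotone.
Qed.

Lemma finitely_many_equations_solvable (J : list I) : exists v, solves J v.
Proof.
  set (J' := nodup (fun i j => excluded_middle_informative (i = j)) J).
  exists (solve J' (fun _ _ => False)); intros i Hi.
  apply solve_solves; [apply NoDup_nodup|apply nodup_In, Hi].
Qed.

Lemma solves_app J J' v : solves (J ++ J') v -> solves J v /\ solves J' v.
Proof. intro H; split; intros i Hi; apply H, in_or_app; auto. Qed.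

(** * Adequacy of typing *)

Lemma interp_tequiv U V : tequiv F U V ->
  exists J, forall v, solves J v -> interp v U = interp v V.
Proof.
  induction 1 as [i|U|U V _ [J H]|U V W _ [J H] _ [J' H']|U U' V V' _ [J H] _ [J' H']].
  - exists [i]; intros v Hv; apply Hv; left; reflexivity.
  - exists []; reflexivity.
  - exists J; intros v Hv; symmetry; auto.
  - exists (J ++ J'); intros v Hv; apply solves_app in Hv; destruct Hv.
    rewrite H, H' by assumption; reflexivity.
  - exists (J ++ J'); intros v Hv; apply solves_app in Hv; destruct Hv; simpl.
    rewrite H, H' by assumption; reflexivity.
Qed.

(** A mu-variable declared with type [U] stands for a stack of [U]. The renaming [r] may be
    non-injective, since the case of [Mu] can identify mu-variables. *)
Definition adequate (v : I -> stacks) (G D : ctx A I) (M : term) (T : ty A I) : Prop :=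
  forall s r p,
    (forall x U, G x = Some U -> orth (interp v U) (s x)) ->
    (forall a U, D a = Some U -> stack_of (interp v U) (p a)) ->
    orth (interp v T) (sub s r p M).

(** On a nonempty stack [N :: l], head expansion reduces the claim to the body under the
    substitution extended by [N]. *)
Lemma adequate_Lam v G D M U V :
  adequate v (extend U G) D M V -> adequate v G D (Lam M) (Arr U V).
Proof.
  intros IH s r p Hs Hp.
  assert (HM : forall N, orth (interp v U) N ->
                 orth (interp v V) (sub (scons N s) r p M)).
  { intros N HN; apply IH; [|exact Hp].
    intros [|x] W HW; simpl in *; [injection HW as <-; exact HN|eauto]. }
  simpl; intros [|N l] Hl.
  - (* The substituted body is normalizing because one of its instances is. *)
    apply SN_Lam; specialize (HM (Var 0) (orth_Var _ _)); apply orth_SN in HM.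
    rewrite <- subst0_sub, subst0_as_sub in HM; eapply SN_sub, HM.
  - destruct Hl as [|[[HN Hl] _]]; [discriminate|].
    apply SN_fire; [eapply orth_SN, HN|exact Logic.I|]; simpl.
    rewrite subst0_sub; apply HM; assumption.
Qed.

(** The stack [l] on which [Mu M] is tested becomes the stack of the bound mu-variable, and it
    remains to normalize the body alone. *)
Lemma adequate_Mu v G D M U :
  adequate v G (extend U D) M (Atom bot) -> adequate v G D (Mu M) U.
Proof.
  intros IH s r p Hs Hp l Hl; simpl.
  apply SN_apps_Mu; [eapply stack_of_SN, Hl|].
  (* Merging the bound mu-variable 0 with a free one undoes the shifts of [s], [p] and [l], so
     that the interpretations need not be closed under renaming. *)
  apply (SN_sub Var Nat.pred (fun _ => [])).
  rewrite !sub_sub.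
  assert (HS : forall q N, (forall a, q (S a) = []) ->
                 sub Var Nat.pred q (mshift N) = N).
  { intros q N Hq; unfold mshift; rewrite sub_rename.
    rewrite <- (sub_id N) at 2; apply sub_ext; [reflexivity|reflexivity|exact Hq]. }
  erewrite sub_ext.
  - apply (orth_SN (interp v (Atom bot))), (IH s (scons 0 r) (scons l p)); [exact Hs|].
    intros [|a] W HW; simpl in *; [injection HW as <-; exact Hl|eauto].
  - intro x; apply HS; reflexivity.
  - intros [|a]; reflexivity.
  - intros [|a]; simpl; rewrite !app_nil_r, map_map; apply map_fixed;
      intro N; apply HS; reflexivity.
Qed.

Lemma typing_adequate G D M T : typing bot F G D M T ->
  exists J, forall v, solves J v -> adequate v G D M T.
Proof.
  induction 1 as [G D x U Hx|G D M U V _ [J H] HE|G D M U V _ [J H]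
    |G D M N U V _ [J H] _ [J' H']|G D M U _ [J H]|G D a M U Ha _ [J H]].
  - exists []; intros v _ s r p Hs Hp; apply Hs, Hx.
  - apply interp_tequiv in HE; destruct HE as [J' HE].
    exists (J ++ J'); intros v Hv; apply solves_app in Hv; destruct Hv.
    intros s r p Hs Hp; rewrite <- HE by assumption; apply H; assumption.
  - exists J; intros v Hv; apply adequate_Lam; auto.
  - exists (J ++ J'); intros v Hv; apply solves_app in Hv; destruct Hv.
    intros s r p Hs Hp; simpl; eapply orth_App; [eapply H|eapply H']; eassumption.
  - exists J; intros v Hv; apply adequate_Mu; auto.
  (* The interpretation of [bot] is empty, so only the empty stack is tested; the stack [p a] is
     admissible for the named term. *)
  - exists J; intros v Hv s r p Hs Hp l [->|[[] _]]; simpl.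
    apply SN_Name, (H v Hv); eauto.
Qed.

End Types.

Lemma SN_strongly_normalizing M : SN M -> strongly_normalizing M.
Proof.
  induction 1 as [M _ IH]; intros (f & H0 & Hf); subst M.
  apply (IH (f 1)); [apply Hf|]; exists (fun n => f (S n)); auto.
Qed.

Theorem mainTheorem2 (A I : Type) (bot : A) (F : I -> ty A I) :
  good F ->
  forall (G D : ctx A I) (M : term) (T : ty A I),
    typing bot F G D M T -> strongly_normalizing M.
Proof.
  intros HF G D M T HM.
  apply typing_adequate in HM; destruct HM as [J HM].
  destruct (finitely_many_equations_solvable _ _ F HF J) as [v Hv].
  (* The identity substitution is admissible: variables belong to every interpretation, and the
     empty stack to every [stack_of]. *)
  apply SN_strongly_normalizing, (SN_sub Var (fun a => a) (fun _ => [])).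
  apply (orth_SN (interp _ _ v T)), (HM v Hv).
  - intros x U _; apply orth_Var.
  - intros a U _; left; reflexivity.
Qed.
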